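(* Let $f_0=h_0+\overline{g_0}\in\mathcal{C}_H^0$, where $$h_0(z)=\frac{2z-z^2}{2(1-z)^2},\qquad g_0(z)=\frac{-z^2}{2(1-z)^2}.$$ The harmonic section $$s_{3,3}(f_0)(z)=s_3(h_0)(z)+\overline{s_3(g_0)(z)}=z+\frac{3}{2}z^2+2z^3-\frac12\overline{z}^2-\overline{z}^3$$ is not convex in the disk $|z|<1/4$.
   Context: Let $\mathbb{D}=\{z\in\mathbb{C}:|z|<1\}$. $\mathcal{C}_H^0$ is the class of harmonic functions $f=h+\overline{g}$ on $\mathbb{D}$ ($h,g$ analytic, $h(0)=0$, $h'(0)=1$, $g(0)=g'(0)=0$) that are sense-preserving ($|h'|^2-|g'|^2>0$) and univalent (injective) in $\mathbb{D}$ and for which $f(\mathbb{D})$ is convex. The function $f_0$ belongs to this class and maps $\mathbb{D}$ onto the half-plane $\{w:\mathrm{Re}\,w>-1/2\}$. For an analytic function $u(z)=\sum_{k\ge1}u_kz^k$, $s_3(u)(z)=\sum_{k=1}^3u_kz^k$. A harmonic function is convex in $|z|<r$ if it is univalent in $|z|<r$ and the image of $|z|<r$ is convex. *)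

(* Defs.v *)
(* Stdlib reals with Coquelicot's complex numbers C. *)
From Stdlib Require Import Reals ClassicalEpsilon.
From Coquelicot Require Import Coquelicot.

Open Scope R_scope.
Open Scope C_scope.

Definition disk (r : R) (z : C) : Prop := (Cmod z < r)%R.

Definition analytic_on_unit_disk (u : C -> C) : Prop :=
  forall z : C, disk 1 z -> ex_derive (K := C_AbsRing) (V := C_NormedModule) u z.

(* The harmonic function h + conj g, carried together with its two analytic
   parts: under the normalization in [in_CH0] the function determines them. *)
Record harmonic_map := Harmonic {
  analytic_part : C -> C;
  coanalytic_part : C -> C
}.

Definition harmonic_eval (f : harmonic_map) (z : C) : C :=
  analytic_part f z + Cconj (coanalytic_part f z).

Coercion harmonic_eval : harmonic_map >-> Funclass.

Definition univalent_in (f : C -> C) (r : R) : Prop :=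
  forall z1 z2 : C, disk r z1 -> disk r z2 -> f z1 = f z2 -> z1 = z2.

Definition image_of_disk (f : C -> C) (r : R) (w : C) : Prop :=
  exists z : C, disk r z /\ f z = w.

Definition convex_set (S : C -> Prop) : Prop :=
  forall (w1 w2 : C) (t : R), S w1 -> S w2 -> (0 <= t <= 1)%R ->
    S (RtoC (1 - t) * w1 + RtoC t * w2).

Definition convex_in_disk (f : C -> C) (r : R) : Prop :=
  univalent_in f r /\ convex_set (image_of_disk f r).

Definition sense_preserving (f : harmonic_map) : Prop :=
  forall z : C, disk 1 z ->
    (Cmod (C_derive (analytic_part f) z) ^ 2
     - Cmod (C_derive (coanalytic_part f) z) ^ 2 > 0)%R.

Definition in_CH0 (f : harmonic_map) : Prop :=
  analytic_on_unit_disk (analytic_part f) /\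
  analytic_on_unit_disk (coanalytic_part f) /\
  analytic_part f 0 = 0 /\ C_derive (analytic_part f) 0 = 1 /\
  coanalytic_part f 0 = 0 /\ C_derive (coanalytic_part f) 0 = 0 /\
  sense_preserving f /\
  univalent_in f 1 /\
  convex_set (image_of_disk f 1).

Definition power_series_on_unit_disk (u : C -> C) (a : nat -> C) : Prop :=
  forall z : C, disk 1 z ->
    is_pseries (K := C_AbsRing) (V := C_NormedModule) a z (u z).

(* The power series coefficients of u at 0; unspecified when u has no power
   series expansion on the unit disk. *)
Definition coeffs (u : C -> C) : nat -> C :=
  epsilon (inhabits (fun _ => RtoC 0)) (power_series_on_unit_disk u).

(* The index starts at 1: only functions vanishing at 0 are considered. *)
Definition partial_sum (n : nat) (u : C -> C) (z : C) : C :=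
  sum_n_m (G := C_AbelianMonoid) (fun k => coeffs u k * z ^ k) 1 n.

Definition harmonic_section (p q : nat) (f : harmonic_map) : harmonic_map :=
  Harmonic (partial_sum p (analytic_part f)) (partial_sum q (coanalytic_part f)).

Definition h0 (z : C) : C := (2 * z - z ^ 2) / (2 * (1 - z) ^ 2).

Definition g0 (z : C) : C := (- z ^ 2) / (2 * (1 - z) ^ 2).

Definition f0 : harmonic_map := Harmonic h0 g0.

(* Main.v *)
(* With [zeta = z / (1 - z)] one has [f0 z = Re zeta + i Im zeta (1 + 2 Re zeta)],
   a bijection of the half-plane [Re > -1/2] after a Moebius map; this gives
   the membership of [f0] in the class.
   For the failure of convexity, a point [z0] slightly outside [|z| < 1/4] is
   chosen where the curve [s(|z| = 1/4)] bends inwards, so that [s z0] is a convex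
   combination of [0 = s 0], [s z1] and [s z2] with [z1], [z2] inside.
   Factoring [z - z0] out of the two analytic parts of [s z - s z0] leaves
   [(z - z0) Q = conj ((z - z0) P)] with [Re Q > |P|], so that [s z0] is not
   attained in the disk. *)
Require Import Defs.
From Stdlib Require Import Reals Lra Lia ClassicalEpsilon.
From Coquelicot Require Import Coquelicot.

Open Scope R_scope.
Open Scope C_scope.

(** * Disks and the complex derivatives of [h0] and [g0] *)

Lemma Cmod_sqr (z : C) : (Cmod z ^ 2 = fst z ^ 2 + snd z ^ 2)%R.
Proof. exact (Cmod2_alt z). Qed.

Lemma disk_sqr (r : R) (z : C) :
  (0 < r)%R -> disk r z <-> (fst z ^ 2 + snd z ^ 2 < r ^ 2)%R.
Proof.
  intros Hr; unfold disk; rewrite <- Cmod_sqr.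
  pose proof (Cmod_ge_0 z); split; intros H0; nra.
Qed.

Lemma disk_1_sub_neq_0 (z : C) : disk 1 z -> 1 - z <> 0.
Proof.
  intros Hz E; unfold disk in Hz.
  replace z with (1 - (1 - z)) in Hz by ring.
  rewrite E in Hz; replace (1 - 0) with (RtoC 1) in Hz by ring.
  rewrite Cmod_1 in Hz; lra.
Qed.

(** The product rule is stated for a ring seen as a module over itself, while
    [analytic_on_unit_disk] uses [C_NormedModule]. The norm is [Cmod] in both, so only the linearity
    record needs repacking. *)
Lemma is_derive_C_NormedModule (f : C -> C) (z l : C) :
  is_derive (K := C_AbsRing) (V := AbsRing_NormedModule C_AbsRing) f z l ->
  is_derive (K := C_AbsRing) (V := C_NormedModule) f z l.
Proof.
  intros [[Hp Hs Hn] Hd]; split; [split; assumption | exact Hd].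
Qed.

Lemma is_derive_inv_1_sub (z : C) :
  1 - z <> 0 ->
  is_derive (K := C_AbsRing) (V := AbsRing_NormedModule C_AbsRing)
    (fun y : C => / (1 - y)) z (/ (1 - z) ^ 2).
Proof.
  intros Hz; split; [apply is_linear_scal_l |].
  intros x Hx eps.
  pose proof (is_filter_lim_locally_unique (V := AbsRing_NormedModule C_AbsRing) z x Hx) as E.
  rewrite <- E; clear x Hx E.
  pose proof (proj1 (Cmod_gt_0 _) Hz) as Hm.
  set (m := Cmod (1 - z)) in Hm.
  pose proof (cond_pos eps) as He.
  assert (Hm3 : (0 < eps * m ^ 2)%R) by (apply Rmult_lt_0_compat; [lra | nra]).
  (* The first bound keeps [Cmod (1 - y)] above [m / 2]. The second then absorbs the linearization
     error, which is exactly [(y - z)^2 / ((1 - y) (1 - z)^2)]. *)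
  assert (Hd : (0 < Rmin (m / 2) (eps * m ^ 2 * (m / 2)))%R).
  { apply Rmin_glb_lt; [lra |]. apply Rmult_lt_0_compat; lra. }
  exists (mkposreal _ Hd); intros y Hy.
  assert (Hyz : (Cmod (y - z) < Rmin (m / 2) (eps * m ^ 2 * (m / 2)))%R)
    by exact Hy.
  pose proof (Rmin_l (m / 2) (eps * m ^ 2 * (m / 2))).
  pose proof (Rmin_r (m / 2) (eps * m ^ 2 * (m / 2))).
  assert (Hy2 : (m / 2 <= Cmod (1 - y))%R).
  { pose proof (Cmod_triangle (1 - y) (y - z)) as T.
    replace (1 - y + (y - z)) with (1 - z) in T by ring.
    fold m in T; lra. }
  assert (Hy0 : 1 - y <> 0) by (apply Cmod_gt_0; lra).
  change (Cmod ((/ (1 - y) - / (1 - z)) - (y - z) * / (1 - z) ^ 2)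
          <= eps * Cmod (y - z))%R.
  replace ((/ (1 - y) - / (1 - z)) - (y - z) * / (1 - z) ^ 2)
    with ((y - z) * (y - z) / ((1 - y) * (1 - z) ^ 2)) by (field; auto).
  rewrite Cmod_div, !Cmod_mult, Cmod_pow; fold m.
  2: { apply Cmult_neq_0; [auto |]. simpl; rewrite Cmult_1_r.
       apply Cmult_neq_0; auto. }
  assert (Hden : (0 < Cmod (1 - y) * m ^ 2)%R)
    by (apply Rmult_lt_0_compat; nra).
  apply Rle_div_l; [exact Hden |].
  rewrite (Rmult_comm eps), Rmult_assoc.
  apply Rmult_le_compat_l; [apply Cmod_ge_0 |].
  assert (eps * m ^ 2 * (m / 2) <= eps * m ^ 2 * Cmod (1 - y))%R
    by (apply Rmult_le_compat_l; lra).
  lra.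
Qed.

(** As polynomials in [/ (1 - z)], both [h0] and [g0] can be differentiated from
    [is_derive_inv_1_sub] alone. *)
Lemma h0_eq (z : C) : 1 - z <> 0 -> h0 z = (/ (1 - z) * / (1 - z) - 1) * / 2.
Proof. intros Hz; unfold h0; field; auto. Qed.

Lemma g0_eq (z : C) :
  1 - z <> 0 -> g0 z = (/ (1 - z) - 1) * (/ (1 - z) - 1) * - / 2.
Proof. intros Hz; unfold g0; field; auto. Qed.

Lemma locally_1_sub_neq_0 (z : C) :
  1 - z <> 0 -> locally (T := AbsRing_UniformSpace C_AbsRing) z (fun y : C => 1 - y <> 0).
Proof.
  intros Hz.
  exists (mkposreal _ (proj1 (Cmod_gt_0 _) Hz)); intros y Hy E.
  assert (H : (Cmod (y - z) < Cmod (1 - z))%R) by exact Hy.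
  replace (y - z) with ((1 - z) - (1 - y)) in H by ring.
  rewrite E in H; replace (1 - z - 0) with (1 - z) in H by ring; lra.
Qed.

Lemma is_derive_h0 (z : C) :
  1 - z <> 0 ->
  is_derive (K := C_AbsRing) (V := C_NormedModule) h0 z (/ (1 - z) ^ 3).
Proof.
  intros Hz; apply is_derive_C_NormedModule.
  apply (is_derive_ext_loc (V := AbsRing_NormedModule C_AbsRing)
    (fun y : C => (/ (1 - y) * / (1 - y) - 1) * / 2)).
  { apply (filter_imp (fun y : C => 1 - y <> 0)); [| now apply locally_1_sub_neq_0].
    intros y Hy; symmetry; now apply h0_eq. }
  pose proof (is_derive_inv_1_sub z Hz) as D.
  pose proof (is_derive_mult _ _ _ _ _ D D Cmult_comm) as D2.
  pose proof (is_derive_minus _ _ _ _ _ D2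
    (is_derive_const (V := AbsRing_NormedModule C_AbsRing) (RtoC 1) z)) as D3.
  pose proof (is_derive_scal_l _ _ _ (/ 2 : AbsRing_NormedModule C_AbsRing) D3) as D4.
  evar (l : C); replace (/ (1 - z) ^ 3) with l; [exact D4 |].
  unfold l.
  change ((/ (1 - z) ^ 2 * / (1 - z) + / (1 - z) * / (1 - z) ^ 2 - 0) * / 2
          = / (1 - z) ^ 3).
  field; auto.
Qed.

Lemma is_derive_g0 (z : C) :
  1 - z <> 0 ->
  is_derive (K := C_AbsRing) (V := C_NormedModule) g0 z (- z / (1 - z) ^ 3).
Proof.
  intros Hz; apply is_derive_C_NormedModule.
  apply (is_derive_ext_loc (V := AbsRing_NormedModule C_AbsRing)
    (fun y : C => (/ (1 - y) - 1) * (/ (1 - y) - 1) * - / 2)).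
  { apply (filter_imp (fun y : C => 1 - y <> 0)); [| now apply locally_1_sub_neq_0].
    intros y Hy; symmetry; now apply g0_eq. }
  pose proof (is_derive_minus _ _ _ _ _ (is_derive_inv_1_sub z Hz)
    (is_derive_const (V := AbsRing_NormedModule C_AbsRing) (RtoC 1) z)) as D.
  pose proof (is_derive_mult _ _ _ _ _ D D Cmult_comm) as D2.
  pose proof (is_derive_scal_l _ _ _ (- / 2 : AbsRing_NormedModule C_AbsRing) D2) as D4.
  evar (l : C); replace (- z / (1 - z) ^ 3) with l; [exact D4 |].
  unfold l.
  change (((/ (1 - z) ^ 2 - 0) * (/ (1 - z) - 1)
           + (/ (1 - z) - 1) * (/ (1 - z) ^ 2 - 0)) * - / 2
          = - z / (1 - z) ^ 3).
  field; auto.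
Qed.

(** * Membership of [f0] in the class *)

Lemma sense_preserving_f0 : sense_preserving f0.
Proof.
  intros z Hz; pose proof (disk_1_sub_neq_0 z Hz) as Hn.
  cbn [analytic_part coanalytic_part f0].
  rewrite (is_C_derive_unique _ _ _ (is_derive_h0 z Hn)).
  rewrite (is_C_derive_unique _ _ _ (is_derive_g0 z Hn)).
  assert (H3 : (1 - z) ^ 3 <> 0)
    by (simpl; rewrite Cmult_1_r; repeat apply Cmult_neq_0; auto).
  rewrite Cmod_div, Cmod_opp, Cmod_inv by auto.
  pose proof (proj1 (Cmod_gt_0 _) H3) as Hp.
  unfold disk in Hz; pose proof (Cmod_ge_0 z).
  (* The dilatation is [- z], so the Jacobian is [(1 - |z|^2) / |1 - z|^6]. *)
  replace ((/ Cmod ((1 - z) ^ 3)) ^ 2 - (Cmod z / Cmod ((1 - z) ^ 3)) ^ 2)%R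
    with ((1 - Cmod z ^ 2) * (/ Cmod ((1 - z) ^ 3)) ^ 2)%R by (field; lra).
  apply Rlt_gt, Rmult_lt_0_compat; [nra |].
  apply pow_lt, Rinv_0_lt_compat, Hp.
Qed.

(** With [zeta = z / (1 - z)], [h0 z = zeta + zeta^2 / 2] and [g0 z = - zeta^2 / 2], hence
    [f0 z = zeta + i Im (zeta^2)]. *)
Lemma f0_moebius (z : C) :
  1 - z <> 0 ->
  f0 z = (fst (z / (1 - z)),
          (snd (z / (1 - z))%C * (1 + 2 * fst (z / (1 - z))%C))%R).
Proof.
  intros Hz; cbv beta delta [harmonic_eval]; cbn [analytic_part coanalytic_part f0].
  replace (h0 z) with (z / (1 - z) + z / (1 - z) * (z / (1 - z)) * / 2).
  2: { unfold h0; field; auto. }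
  replace (g0 z) with (- (z / (1 - z) * (z / (1 - z)) * / 2)).
  2: { unfold g0; field; auto. }
  destruct (z / (1 - z)) as [u v].
  apply injective_projections; simpl; field.
Qed.

(** From [zeta = z (1 + zeta)] and [|z| < 1] follows [|zeta| < |1 + zeta|]: [zeta] is closer to 0
    than to -1. *)
Lemma moebius_half_plane (z : C) :
  disk 1 z -> (fst (z / (1 - z))%C > - 1 / 2)%R.
Proof.
  intros Hz; pose proof (disk_1_sub_neq_0 z Hz) as Hn.
  assert (E : z / (1 - z) = z * (1 + z / (1 - z))) by (field; auto).
  apply (f_equal (fun w => (Cmod w ^ 2)%R)) in E.
  rewrite Cmod_mult, Rpow_mult_distr, !Cmod_sqr in E.
  apply disk_sqr in Hz; [| lra].
  assert (N : 1 + z / (1 - z) <> 0).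
  { replace (1 + z / (1 - z)) with (/ (1 - z)) by (field; auto).
    apply Cmod_gt_0; rewrite Cmod_inv by auto.
    now apply Rinv_0_lt_compat, Cmod_gt_0. }
  apply Cmod_gt_0, (pow_lt _ 2) in N; rewrite Cmod_sqr in N.
  destruct (z / (1 - z)) as [u v]; simpl in *; nra.
Qed.

Lemma univalent_f0 : univalent_in f0 1.
Proof.
  intros z1 z2 H1 H2 E.
  pose proof (disk_1_sub_neq_0 z1 H1) as N1.
  pose proof (disk_1_sub_neq_0 z2 H2) as N2.
  rewrite !f0_moebius in E by auto.
  pose proof (moebius_half_plane z1 H1) as P1.
  assert (Z : z1 / (1 - z1) = z2 / (1 - z2)).
  (* The real parts agree at once; the imaginary parts agree after cancelling the positive factor
     [1 + 2 Re zeta]. *)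
  { destruct (z1 / (1 - z1)) as [u1 v1], (z2 / (1 - z2)) as [u2 v2]; simpl in *.
    injection E as E1 E2; subst u2; f_equal.
    apply Rmult_eq_reg_r in E2; lra. }
  apply (f_equal (fun w => w * (1 - z1) * (1 - z2))) in Z.
  replace z1 with (z1 / (1 - z1) * (1 - z1) * (1 - z2) + z1 * z2) by (field; auto).
  rewrite Z; field; auto.
Qed.

Lemma image_f0 (w : C) : image_of_disk f0 1 w <-> (fst w > - 1 / 2)%R.
Proof.
  split.
  { intros [z [Hz <-]]; rewrite f0_moebius by now apply disk_1_sub_neq_0.
    exact (moebius_half_plane z Hz). }
  destruct w as [x y]; simpl; intros Hx.
  (* [m] is the required value of [zeta], and [m / (1 + m)] inverts [z / (1 - z)]. *)
  set (m := (x, y / (1 + 2 * x))%R : C).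
  assert (Hn : 1 + m <> 0).
  { intros E; apply (f_equal fst) in E; unfold m in E; simpl in E; lra. }
  exists (m / (1 + m)).
  assert (Hd : disk 1 (m / (1 + m))).
  { unfold disk; rewrite Cmod_div by auto.
    pose proof (proj1 (Cmod_gt_0 _) Hn) as Hp.
    apply Rlt_div_l; [exact Hp |].
    assert (Cmod m ^ 2 < Cmod (1 + m) ^ 2)%R
      by (rewrite !Cmod_sqr; unfold m; simpl; lra).
    pose proof (Cmod_ge_0 m); nra. }
  split; [exact Hd |].
  rewrite f0_moebius by now apply disk_1_sub_neq_0.
  replace (m / (1 + m) / (1 - m / (1 + m))) with m.
  { unfold m; simpl; f_equal; field; lra. }
  field; split; [exact Hn |].
  replace (1 + m - m) with (RtoC 1) by ring; apply C1_nz.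
Qed.

Lemma in_CH0_f0 : in_CH0 f0.
Proof.
  assert (N0 : 1 - 0 <> 0) by (replace (1 - 0) with (RtoC 1) by ring; apply C1_nz).
  split; [| split; [| split; [| split; [| split; [| split; [| split; [| split]]]]]]].
  - intros z Hz; eexists; apply is_derive_h0; now apply disk_1_sub_neq_0.
  - intros z Hz; eexists; apply is_derive_g0; now apply disk_1_sub_neq_0.
  - simpl; unfold h0; field; auto.
  - simpl; rewrite (is_C_derive_unique _ _ _ (is_derive_h0 0 N0)); field; auto.
  - simpl; unfold g0; field; auto.
  - simpl; rewrite (is_C_derive_unique _ _ _ (is_derive_g0 0 N0)); field; auto.
  - exact sense_preserving_f0.
  - exact univalent_f0.
  - intros w1 w2 t; rewrite !image_f0; intros H1 H2 Ht; simpl.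
    destruct (Rle_lt_dec t (1 / 2)); nra.
Qed.

(** * Power series expansions and their coefficients *)

Lemma is_lim_seq_nat_mult_pow (x : R) :
  (0 <= x < 1)%R -> is_lim_seq (fun n => INR (S n) * x ^ n)%R 0%R.
Proof.
  intros Hx; set (a := fun _ : nat => 1%R).
  assert (Ha : CV_radius a = 1%R).
  { rewrite (CV_radius_finite_DAlembert a 1).
    - now rewrite Rinv_1.
    - intros n; unfold a; lra.
    - lra.
    - apply (is_lim_seq_ext (fun _ => 1%R)); [| apply is_lim_seq_const].
      intros n; unfold a; replace (1 / 1)%R with 1%R by field; now rewrite Rabs_R1. }
  (* These are the terms of the differentiated geometric series, whose radius of convergence is
     still 1. *)
  apply (is_lim_seq_ext (fun n => scal (pow_n x n) (PS_derive a n))).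
  { intros n; rewrite pow_n_pow; unfold PS_derive, a.
    change (x ^ n * (INR (S n) * 1) = INR (S n) * x ^ n)%R; ring. }
  apply ex_series_lim_0, (CV_radius_inside (PS_derive a)).
  rewrite CV_radius_derive, Ha; simpl; rewrite Rabs_pos_eq; lra.
Qed.

Lemma pow_n_Cpow (z : C) (n : nat) : pow_n (K := C_Ring) z n = z ^ n.
Proof. induction n as [| n IH]; [reflexivity |]; simpl; now rewrite IH. Qed.

(** Coefficients affine in the index leave a remainder [z^n] times an affine function of [n]. This
    exact identity can be proved by induction, and the remainder is at most [(n + 1) |z|^n M], which
    tends to 0. *)
Lemma is_pseries_of_remainder (c : nat -> C) (z l A B : C) :
  disk 1 z ->
  (forall n, sum_n (G := C_AbelianMonoid) (fun k => z ^ k * c k) n - l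
             = z ^ n * (RtoC (INR n) * A + B)) ->
  is_pseries (K := C_AbsRing) (V := C_NormedModule) c z l.
Proof.
  intros Hz H; apply filterlim_locally; intros eps.
  set (M := (Cmod A + Cmod B + 1)%R).
  pose proof (Cmod_ge_0 A); pose proof (Cmod_ge_0 B).
  assert (HM : (0 < M)%R) by (unfold M; lra).
  assert (He : (0 < eps / M)%R) by (apply Rdiv_lt_0_compat; [apply cond_pos | lra]).
  pose proof (conj (Cmod_ge_0 z) Hz) as Hz1.
  pose proof (is_lim_seq_nat_mult_pow _ Hz1) as L.
  apply is_lim_seq_spec in L; destruct (L (mkposreal _ He)) as [N HN].
  exists N; intros n Hn; specialize (HN n Hn); cbn [pos] in HN.
  apply C_NormedModule_mixin_compat1.
  replace (minus _ l) with (z ^ n * (RtoC (INR n) * A + B)).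
  2: { rewrite <- H; reflexivity. }
  rewrite Cmod_mult, Cmod_pow.
  pose proof (Cmod_triangle (RtoC (INR n) * A) B) as T.
  rewrite Cmod_mult, Cmod_R, (Rabs_pos_eq _ (pos_INR n)) in T.
  pose proof (pos_INR n) as Pn.
  assert (T2 : (Cmod (RtoC (INR n) * A + B) <= INR (S n) * M)%R).
  { rewrite S_INR; unfold M; nra. }
  rewrite Rminus_0_r in HN.
  apply Rabs_lt_between in HN; destruct HN as [_ HN].
  apply Rlt_div_r in HN; [| exact HM].
  pose proof (pow_le _ n (Cmod_ge_0 z)).
  nra.
Qed.

Lemma is_series_C_components (a : nat -> C) (l : C) :
  is_series (K := C_AbsRing) (V := C_NormedModule) a l ->
  is_series (fun n => fst (a n)) (fst l) /\ is_series (fun n => snd (a n)) (snd l).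
Proof.
  intros H; destruct l as [x y].
  assert (S : forall n, fst (sum_n a n) = sum_n (fun k => fst (a k)) n
                     /\ snd (sum_n a n) = sum_n (fun k => snd (a k)) n).
  { induction n as [| n [IH1 IH2]]; [now rewrite !sum_O |].
    rewrite !sum_Sn, <- IH1, <- IH2; split; reflexivity. }
  split.
  - apply (filterlim_ext (fun n => fst (sum_n a n))); [apply S |].
    apply (filterlim_comp _ _ _ (fun n => sum_n a n : C) fst _ _ _ H).
    apply (continuous_fst (U := R_UniformSpace) (V := R_UniformSpace)).
  - apply (filterlim_ext (fun n => snd (sum_n a n))); [apply S |].
    apply (filterlim_comp _ _ _ (fun n => sum_n a n : C) snd _ _ _ H).
    apply (continuous_snd (U := R_UniformSpace) (V := R_UniformSpace)).
Qed.

Lemma RtoC_pow (x : R) (n : nat) : RtoC x ^ n = RtoC (x ^ n).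
Proof.
  induction n as [| n IH]; [reflexivity |].
  simpl; now rewrite IH, RtoC_mult.
Qed.

(** Outside the disk of convergence the terms do not tend to 0, as they must at [/ 2]. *)
Lemma CV_radius_pos (a : nat -> R) :
  ex_pseries a (/ 2)%R -> Rbar_lt 0%R (CV_radius a).
Proof.
  intros H; apply Rbar_not_le_lt; intros Hr.
  apply (CV_disk_outside a (/ 2)%R).
  - apply (Rbar_le_lt_trans _ _ _ Hr); simpl; rewrite Rabs_pos_eq; lra.
  - apply (is_lim_seq_ext (fun n => scal (pow_n (/ 2)%R n) (a n)));
      [| now apply ex_series_lim_0].
    intros n; rewrite pow_n_pow; apply Rmult_comm.
Qed.

Lemma real_pseries_coeffs_unique (a b : nat -> R) (u : R -> R) (n : nat) :
  (forall x, Rabs x < 1 -> is_pseries a x (u x))%R ->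
  (forall x, Rabs x < 1 -> is_pseries b x (u x))%R ->
  a n = b n.
Proof.
  intros Ha Hb.
  assert (H2 : (Rabs (/ 2) < 1)%R) by (rewrite Rabs_pos_eq; lra).
  apply PSeries_ext_recip.
  - apply CV_radius_pos; eexists; now apply Ha.
  - apply CV_radius_pos; eexists; now apply Hb.
  - exists (mkposreal 1 Rlt_0_1); intros x Hx.
    assert (Hx1 : (Rabs x < 1)%R).
    { change (Rabs (x - 0) < 1)%R in Hx; now rewrite Rminus_0_r in Hx. }
    now rewrite (is_pseries_unique _ _ _ (Ha x Hx1)),
      (is_pseries_unique _ _ _ (Hb x Hx1)).
Qed.

Lemma power_series_real (u : C -> C) (a : nat -> C) (x : R) :
  power_series_on_unit_disk u a -> (Rabs x < 1)%R ->
  is_pseries (fun n => fst (a n)) x (fst (u (RtoC x))) /\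
  is_pseries (fun n => snd (a n)) x (snd (u (RtoC x))).
Proof.
  intros Ha Hx.
  assert (Hd : disk 1 (RtoC x)) by (unfold disk; now rewrite Cmod_R).
  destruct (is_series_C_components _ _ (Ha _ Hd)) as [H1 H2].
  split; (eapply is_series_ext; [| eassumption]); intros n; cbn beta;
    rewrite pow_n_Cpow, pow_n_pow, RtoC_pow;
    destruct (a n) as [p q]; cbn; ring.
Qed.

(** Restricting to the real axis and splitting into components reduces this to uniqueness for real
    power series. *)
Lemma power_series_coeffs_unique (u : C -> C) (a b : nat -> C) (n : nat) :
  power_series_on_unit_disk u a -> power_series_on_unit_disk u b -> a n = b n.
Proof.
  intros Ha Hb; apply injective_projections.
  - exact (real_pseries_coeffs_unique _ _ _ n
      (fun x Hx => proj1 (power_series_real u a x Ha Hx))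
      (fun x Hx => proj1 (power_series_real u b x Hb Hx))).
  - exact (real_pseries_coeffs_unique _ _ _ n
      (fun x Hx => proj2 (power_series_real u a x Ha Hx))
      (fun x Hx => proj2 (power_series_real u b x Hb Hx))).
Qed.

(** Since [coeffs] is chosen by [epsilon], uniqueness is what lets an explicit expansion compute
    it. *)
Lemma coeffs_eq (u : C -> C) (a : nat -> C) (n : nat) :
  power_series_on_unit_disk u a -> coeffs u n = a n.
Proof.
  intros Ha; apply (power_series_coeffs_unique u); [| exact Ha].
  unfold coeffs; apply epsilon_spec; now exists a.
Qed.

Lemma power_series_h0 :
  power_series_on_unit_disk h0
    (fun k => match k with 0%nat => 0 | _ => (RtoC (INR k) + 1) / 2 end).
Proof.
  intros z Hz; pose proof (disk_1_sub_neq_0 z Hz) as Hn.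
  (* Summing [(k + 1) / 2 * z^k] over [k > n] gives [z^n (n z / (2 (1 - z)) + h0 z)]; the two
     arguments are the negated coefficients of this tail. Those for [g0] arise in the same way. *)
  apply (is_pseries_of_remainder _ _ _ (- z / (2 * (1 - z)))
           ((z ^ 2 - 2 * z) / (2 * (1 - z) ^ 2))); [exact Hz |].
  induction n as [| n IH].
  { rewrite sum_O; unfold h0; simpl; field; auto. }
  rewrite sum_Sn, S_INR, RtoC_plus.
  change (plus ?a ?b) with (a + b).
  match goal with |- ?a + ?b - ?c = _ => replace (a + b - c) with (a - c + b) by ring end.
  rewrite IH; simpl (z ^ S n); field; auto.
Qed.

Lemma power_series_g0 :
  power_series_on_unit_disk g0
    (fun k => match k with 0%nat => 0 | _ => (1 - RtoC (INR k)) / 2 end).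
Proof.
  intros z Hz; pose proof (disk_1_sub_neq_0 z Hz) as Hn.
  apply (is_pseries_of_remainder _ _ _ (z / (2 * (1 - z)))
           (z ^ 2 / (2 * (1 - z) ^ 2))); [exact Hz |].
  induction n as [| n IH].
  { rewrite sum_O; unfold g0; simpl; field; auto. }
  rewrite sum_Sn, S_INR, RtoC_plus.
  change (plus ?a ?b) with (a + b).
  match goal with |- ?a + ?b - ?c = _ => replace (a + b - c) with (a - c + b) by ring end.
  rewrite IH; simpl (z ^ S n); field; auto.
Qed.

(** * Failure of convexity *)

Lemma convex_set_three_points (S : C -> Prop) (w1 w2 : C) (s t : R) :
  convex_set S -> S 0 -> S w1 -> S w2 ->
  (0 <= s)%R -> (0 < t)%R -> (s + t <= 1)%R -> S (RtoC s * w1 + RtoC t * w2).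
Proof.
  intros HS H0 H1 H2 Hs Ht Hst.
  (* Two nested binary combinations; the missing weight [1 - (s + t)] goes to 0, and [0 < t] makes
     the division legitimate. *)
  replace (RtoC s * w1 + RtoC t * w2)
    with (RtoC (1 - (s + t)) * 0
          + RtoC (s + t) * (RtoC (1 - t / (s + t)) * w1 + RtoC (t / (s + t)) * w2)).
  { apply HS; [exact H0 | | lra]; apply HS; auto.
    split; [apply Rdiv_le_0_compat; lra | apply Rle_div_l; lra]. }
  destruct w1, w2; apply injective_projections; simpl; field; lra.
Qed.

Definition section33 (z : C) : C :=
  z + 3 / 2 * z ^ 2 + 2 * z ^ 3 - 1 / 2 * Cconj z ^ 2 - Cconj z ^ 3.

(** Its squared modulus is 261/4096, just above 1/16 = 256/4096. *)
Definition omitted_point : C := ((- 3 / 32)%R, (15 / 64)%R).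

(** Both points on the right have squared modulus 250/4096, so they lie inside the disk. The weights
    solve a real 2 by 2 linear system; their sum is about 0.996, and the rest falls on
    [section33 0 = 0]. *)
Lemma section33_convex_comb :
  section33 omitted_point
  = RtoC (156866893 / 588139680) * section33 ((5 / 64)%R, (15 / 64)%R)
    + RtoC (85772929 / 117627936) * section33 ((- 13 / 64)%R, (9 / 64)%R).
Proof. apply injective_projections; simpl; field. Qed.

Lemma section33_omits (z : C) :
  disk (1 / 4) z -> section33 z <> section33 omitted_point.
Proof.
  intros Hz E.
  (* [S] and [T] are the divided differences of the square and the cube; [Q] and [- P] are those of
     the analytic and co-analytic parts. *)
  set (S := z + omitted_point).
  set (T := z ^ 2 + z * omitted_point + omitted_point ^ 2).
  set (P := 1 / 2 * S + T).
  set (Q := 1 + 3 / 2 * S + 2 * T).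
  assert (F : (z - omitted_point) * Q = Cconj ((z - omitted_point) * P)).
  { transitivity ((section33 z - section33 omitted_point)
                  + Cconj ((z - omitted_point) * P)).
    - unfold section33, Q, P, S, T, omitted_point; destruct z as [a b].
      apply injective_projections; simpl; field.
    - rewrite E; ring. }
  apply (f_equal Cmod) in F; rewrite Cmod_conj, !Cmod_mult in F.
  apply Rmult_eq_reg_l in F.
  2: { intros N; apply Cmod_eq_0 in N.
       apply disk_sqr in Hz; [| lra].
       replace z with omitted_point in Hz by (rewrite <- (Cplus_0_l omitted_point), <- N; ring).
       unfold omitted_point in Hz; simpl in Hz; lra. }
  (* The threshold 4/10 separates the two moduli: the triangle inequality on the regrouped [P] gives
     at most about 0.32. *)
  assert (HP : (Cmod P < 4 / 10)%R).
  { replace P with ((1 / 2 + omitted_point) * (z + omitted_point) + z ^ 2)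
      by (unfold P, S, T; field).
    assert (B0 : (Cmod omitted_point < 26 / 100)%R)
      by (apply disk_sqr; [lra |]; simpl; lra).
    assert (B1 : (Cmod (1 / 2 + omitted_point) < 1 / 2)%R)
      by (apply disk_sqr; [lra |]; simpl; lra).
    pose proof (Cmod_triangle ((1 / 2 + omitted_point) * (z + omitted_point)) (z ^ 2)).
    pose proof (Cmod_triangle z omitted_point).
    pose proof (Cmod_ge_0 z); pose proof (Cmod_ge_0 (z + omitted_point)).
    pose proof (Cmod_ge_0 (1 / 2 + omitted_point)).
    rewrite Cmod_mult, Cmod_pow in *; unfold disk in Hz; nra. }
  assert (HQ : (4 / 10 < Cmod Q)%R).
  { apply disk_sqr in Hz; [| lra].
    apply (Rlt_le_trans _ (Re Q)).
    - destruct z as [a b]; unfold Q, S, T, omitted_point, Re; simpl in *.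
      (* Using [b < 1 / 4] in the linear term and [b^2 < 1 / 16 - a^2] in the quadratic one bounds
         [Re Q] below by a quadratic in [a] with minimum about 0.417. *)
      assert (Hb : (b < 1 / 4)%R) by nra.
      nra.
    - apply (Rle_trans _ (Rabs (Re Q))); [apply Rle_abs | apply re_le_Cmod]. }
  lra.
Qed.

Lemma partial_sum_3 (u : C -> C) (z : C) :
  partial_sum 3 u z = coeffs u 1 * z ^ 1 + coeffs u 2 * z ^ 2 + coeffs u 3 * z ^ 3.
Proof.
  unfold partial_sum; do 2 (rewrite sum_n_Sm; [| lia]); now rewrite sum_n_n.
Qed.

Lemma harmonic_section_f0 (z : C) : harmonic_section 3 3 f0 z = section33 z.
Proof.
  unfold harmonic_eval, harmonic_section, section33.
  cbn [analytic_part coanalytic_part f0]; rewrite !partial_sum_3.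
  rewrite !(coeffs_eq _ _ _ power_series_h0), !(coeffs_eq _ _ _ power_series_g0).
  destruct z as [a b]; apply injective_projections; simpl; field.
Qed.

Theorem theorem5 :
  in_CH0 f0 /\
  (forall z : C,
     harmonic_section 3 3 f0 z
     = z + 3 / 2 * z ^ 2 + 2 * z ^ 3
       - 1 / 2 * Cconj z ^ 2 - Cconj z ^ 3) /\
  ~ convex_in_disk (harmonic_section 3 3 f0) (1 / 4)%R.
Proof.
  split; [exact in_CH0_f0 | split; [exact harmonic_section_f0 |]].
  intros [_ Hconv].
  assert (Himg : forall z, disk (1 / 4) z ->
      image_of_disk (harmonic_section 3 3 f0) (1 / 4) (section33 z)).
  { intros z Hz; exists z; split; [exact Hz | apply harmonic_section_f0]. }
  assert (H : image_of_disk (harmonic_section 3 3 f0) (1 / 4)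
                (section33 omitted_point)).
  { rewrite section33_convex_comb.
    apply convex_set_three_points; [exact Hconv | | | | lra | lra | lra].
    - replace (RtoC 0) with (section33 0)
        by (apply injective_projections; simpl; field).
      apply Himg, disk_sqr; simpl; lra.
    - apply Himg, disk_sqr; simpl; lra.
    - apply Himg, disk_sqr; simpl; lra. }
  destruct H as [z [Hz E]]; rewrite harmonic_section_f0 in E.
  exact (section33_omits z Hz E).
Qed.
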